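(* Assume the setting in the context with $d\ge2$. There exist absolute constants $C_1,C_2>0$ such that the following holds. Set $\lambda=C_1\sqrt{M\log d/n}$ and $\tau=(C_2Mn/\log d)^{1/4}$. Let $\hat W$ be any maximizer of $$\langle W,\bar\Sigma\rangle-\lambda\|W\|_1\quad\text{subject to}\quad0\preceq W\preceq I_d,\ \mathrm{trace}(W)=k,$$ and let $\hat V\in\mathbb{R}^{d\times k}$ have as columns orthonormal eigenvectors of $\hat W$ for its $k$ largest eigenvalues. Then with probability at least $1-d^{-2}$, $$\inf_{O\in\mathbb{O}_k}\|\hat V-V^*O\|_F\le\frac{4\sqrt2}{\rho_0}\,s^*\lambda,$$ where $\mathbb{O}_k$ is the set of $k\times k$ orthogonal matrices.
   Context: $X\in\mathbb{R}^d$ is a random vector with $\mathbb{E}X=0$ and covariance $\Sigma=\mathbb{E}[XX^\top]$ with eigenvalues $\lambda_1(\Sigma)\ge\dots\ge\lambda_d(\Sigma)$; $\rho_0=\lambda_k(\Sigma)-\lambda_{k+1}(\Sigma)>0$. $V^*\in\mathbb{R}^{d\times k}$ has as orthonormal columns top-$k$ eigenvectors of $\Sigma$, and $V^*$ has at most $s^*$ nonzero rows. Moments: $\mathbb{E}|X_j|^4\le M$ and $\mathbb{E}|X_jX_l|^2\le M$ for all $j,l\in[d]$. Data: $X_1,\dots,X_n$ i.i.d. copies of $X$. Truncation: for $v\in\mathbb{R}^d$, $\vartheta(v)$ has entries $\vartheta_j(v)=\mathrm{sign}(v_j)\min\{|v_j|,\tau\}$; $\bar X_i=\vartheta(X_i)$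 and $\bar\Sigma=\frac1n\sum_{i=1}^n\bar X_i\bar X_i^\top$. $\|W\|_1=\sum_{j,l}|W_{jl}|$; $\preceq$ is the Loewner order; $\langle A,B\rangle=\mathrm{trace}(A^\top B)$. *)

(* Defs.v *)
From HB Require Import structures.
From mathcomp Require Import all_boot all_order all_algebra.
From mathcomp Require Import all_classical all_reals all_analysis.
From mathcomp Require Import Rstruct Rstruct_topology.


Set Implicit Arguments.
Unset Strict Implicit.
Unset Printing Implicit Defensive.
Import Order.TTheory GRing.Theory Num.Theory.
Local Open Scope ring_scope.
Local Open Scope classical_set_scope.

Notation R := Rdefinitions.R.

Definition psd (d : nat) (A : 'M[R]_d) : Prop :=
  A^T = A /\ forall v : 'cV[R]_d, 0 <= (v^T *m A *m v) 0 0.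

Definition l1norm (m n : nat) (A : 'M[R]_(m, n)) : R :=
  \sum_(i < m) \sum_(j < n) `|A i j|.

Definition frob (m n : nat) (A : 'M[R]_(m, n)) : R :=
  Num.sqrt (\sum_(i < m) \sum_(j < n) A i j ^+ 2).

Definition sorted_eigenvalues (d : nat) (A : 'M[R]_d) (lam : nat -> R) : Prop :=
  (forall i j : nat, (i <= j)%N -> (j < d)%N -> lam j <= lam i) /\
  exists U : 'M[R]_d, U^T *m U = 1%:M /\
    A = U *m diag_mx (\row_(i < d) lam i) *m U^T.

Definition top_eigvecs (d k : nat) (A : 'M[R]_d) (lam : nat -> R)
    (V : 'M[R]_(d, k)) : Prop :=
  V^T *m V = 1%:M /\
  forall i : 'I_k, A *m col i V = lam i *: col i V.

Definition orthogonal_mx (k : nat) (O : 'M[R]_k) : Prop := O^T *m O = 1%:M.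

Definition trunc (d : nat) (tau : R) (v : 'cV[R]_d) : 'cV[R]_d :=
  \col_(j < d) (Num.sg (v j 0) * Num.min `|v j 0| tau).

Definition Sigma_bar (d n : nat) (tau : R) (Xs : 'I_n -> 'cV[R]_d) : 'M[R]_d :=
  n%:R^-1 *: \sum_(i < n) (trunc tau (Xs i) *m (trunc tau (Xs i))^T).

Definition feasible (d k : nat) (W : 'M[R]_d) : Prop :=
  psd W /\ psd (1%:M - W) /\ \tr W = k%:R.

Definition objective (d : nat) (lambda : R) (S W : 'M[R]_d) : R :=
  \tr (W^T *m S) - lambda * l1norm W.

Definition is_maximizer (d k : nat) (lambda : R) (S W : 'M[R]_d) : Prop :=
  feasible k W /\
  forall W' : 'M[R]_d, feasible k W' -> objective lambda S W' <= objective lambda S W.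

Definition covariance_mx {d0} {T : measurableType d0} (P : probability T R)
    (d : nat) (X : T -> 'cV[R]_d) : 'M[R]_d :=
  \matrix_(j < d, l < d) fine (\int[P]_w ((X w j 0 * X w l 0)%:E))%E.

(* the random vectors Y and Z have the same law (checked on measurable
   rectangles, a generating pi-system of the Borel sets of R^d) *)
Definition same_law {d0} {T : measurableType d0} (P : probability T R)
    (d : nat) (Y Z : T -> 'cV[R]_d) : Prop :=
  forall B : 'I_d -> set R, (forall j, measurable (B j : set (measurableTypeR R))) ->
    P [set w | forall j, B j (Y w j 0)] = P [set w | forall j, B j (Z w j 0)].

(* mutual independence of the random vectors Xs 0, ..., Xs (n-1)
   (product rule on measurable rectangles; subfamilies are obtained with
   B i j = setT) *)
Definition mutually_independent {d0} {T : measurableType d0}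
    (P : probability T R) (d n : nat) (Xs : 'I_n -> T -> 'cV[R]_d) : Prop :=
  forall B : 'I_n -> 'I_d -> set R, (forall i j, measurable (B i j : set (measurableTypeR R))) ->
    P [set w | forall i j, B i j (Xs i w j 0)] =
    (\prod_(i < n) P [set w | forall j, B i j (Xs i w j ord0)])%E.

Definition real_measurable {d0} {T : measurableType d0} (f : T -> R) : Prop :=
  measurable_fun setT (f : T -> measurableTypeR R).

(* Main.v *)
Require Import Defs.
From HB Require Import structures.
From mathcomp Require Import all_boot all_order all_algebra.
From mathcomp Require Import all_classical all_reals all_analysis.
From mathcomp Require Import Rstruct Rstruct_topology.
From mathcomp Require Import measurable_realfun ring lra.
Import Order.TTheory GRing.Theory Num.Theory.
Import numFieldNormedType.Exports.
Local Open Scope ring_scope.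
Local Open Scope classical_set_scope.

(** Put [P = V* V*^T], [Q = Vhat Vhat^T] and [r = sqrt (M log d / n)].

    Deterministic part, on the event that every entry of [Sigma_bar - Sigma] is
    at most [(2/5) lambda]: [P] is feasible, so optimality of [What] together
    with the curvature inequality
    [(rho0 / 2) |P - What|_F^2 <= <Sigma, P - What>] and the support of [P]
    gives [|P - What|_F <= (14/5) s lambda / rho0].  By Ky Fan's principle
    [<What, P> <= <What, Q>], hence [|Q - P|_F <= 2 |P - What|_F], and the
    Procrustes distance is at most [|Q - P|_F].  The factor 2 here cannot be
    lowered to [sqrt 2] ([What] may be [I / 2]); the loss is absorbed by
    [7/5 <= sqrt 2], which is why the entrywise error must be a small fraction
    of [lambda], that is, why [C1] is large.

    Probabilistic part: [tau^2 r = M] and [n r / tau^2 = log d].  Truncation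
    changes each second moment by at most [2 M / tau^2 = 2 r], and a Chernoff
    bound with exponent [1 / tau^2] controls the fluctuations by [O(r)] with
    probability [1 - O(d^-5)] per entry.  Since independence is only given on
    rectangles, the truncated coordinates are first rounded to a grid of step
    [r / (2 tau)], which costs another [r] and turns all the expectations
    involving the sample into finite sums. *)

(** * Frobenius inner product and positive semidefinite matrices *)

Definition mxdot (m n : nat) (A B : 'M[R]_(m, n)) : R := \tr (A^T *m B).
Arguments mxdot {m n}.

Lemma mxdotE m n (A B : 'M[R]_(m, n)) :
  mxdot A B = \sum_i \sum_j A i j * B i j.
Proof.
rewrite /mxdot exchange_big; apply: eq_bigr => j _; rewrite mxE.
by apply: eq_bigr => i _; rewrite mxE.
Qed.

Lemma mxdotC m n (A B : 'M[R]_(m, n)) : mxdot A B = mxdot B A.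
Proof. by rewrite /mxdot -mxtrace_tr trmx_mul trmxK. Qed.

Lemma mxdotDl m n (A B C : 'M[R]_(m, n)) :
  mxdot (A + B) C = mxdot A C + mxdot B C.
Proof. by rewrite /mxdot linearD /= mulmxDl linearD. Qed.

Lemma mxdotBl m n (A B C : 'M[R]_(m, n)) :
  mxdot (A - B) C = mxdot A C - mxdot B C.
Proof. by rewrite /mxdot linearB /= mulmxBl linearB. Qed.

Lemma mxdotDr m n (A B C : 'M[R]_(m, n)) :
  mxdot C (A + B) = mxdot C A + mxdot C B.
Proof. by rewrite /mxdot mulmxDr linearD. Qed.

Lemma mxdotBr m n (A B C : 'M[R]_(m, n)) :
  mxdot C (A - B) = mxdot C A - mxdot C B.
Proof. by rewrite /mxdot mulmxBr linearB. Qed.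

Lemma mxdotZl m n a (A B : 'M[R]_(m, n)) : mxdot (a *: A) B = a * mxdot A B.
Proof. by rewrite /mxdot linearZ /= -scalemxAl linearZ. Qed.

Lemma mxdotZr m n a (A B : 'M[R]_(m, n)) : mxdot A (a *: B) = a * mxdot A B.
Proof. by rewrite mxdotC mxdotZl mxdotC. Qed.

Lemma mxdot_mull m n p (A : 'M[R]_(m, n)) (B : 'M[R]_(n, p)) C :
  mxdot (A *m B) C = mxdot B (A^T *m C).
Proof. by rewrite /mxdot trmx_mul mulmxA. Qed.

Lemma mxdot_mulr m n p (A : 'M[R]_(m, n)) (B : 'M[R]_(n, p)) C :
  mxdot (A *m B) C = mxdot A (C *m B^T).
Proof. by rewrite /mxdot trmx_mul -mulmxA mxtrace_mulC mulmxA. Qed.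

Lemma mxdot_ge0 m n (A : 'M[R]_(m, n)) : 0 <= mxdot A A.
Proof.
by rewrite mxdotE; apply: sumr_ge0 => i _; apply: sumr_ge0 => j _; exact: sqr_ge0.
Qed.

Lemma mxdot_eq0 m n (A : 'M[R]_(m, n)) : mxdot A A <= 0 -> A = 0.
Proof.
move=> A0; have /eqP : mxdot A A = 0 by apply/eqP; rewrite eq_le A0 mxdot_ge0.
rewrite mxdotE psumr_eq0 => [/allP Ai|i _]; last first.
  by apply: sumr_ge0 => j _; exact: sqr_ge0.
apply/matrixP => i j; have := Ai i (mem_index_enum _).
rewrite psumr_eq0 => [/allP /(_ j (mem_index_enum _))|l _]; last exact: sqr_ge0.
by rewrite mulf_eq0 orbb mxE => /eqP.
Qed.

Lemma frob_sqr m n (A : 'M[R]_(m, n)) : frob A ^+ 2 = mxdot A A.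
Proof.
rewrite /frob sqr_sqrtr ?mxdotE; first by [].
by apply: sumr_ge0 => i _; apply: sumr_ge0 => j _; exact: sqr_ge0.
Qed.

Lemma frob_ge0 m n (A : 'M[R]_(m, n)) : 0 <= frob A.
Proof. exact: sqrtr_ge0. Qed.

(** Expands the squared norm of [<A,A> B - <A,B> A] and cancels one factor [<A,A>]. *)
Lemma mxdot_CS m n (A B : 'M[R]_(m, n)) :
  mxdot A B ^+ 2 <= mxdot A A * mxdot B B.
Proof.
have := mxdot_ge0 _ _ A; rewrite le_eqVlt => /orP[/eqP A0|Agt0].
  have -> : A = 0 by apply: mxdot_eq0; rewrite -A0.
  by rewrite /mxdot trmx0 !mul0mx !mxtrace0 expr0n mul0r.
have := mxdot_ge0 _ _ (mxdot A A *: B - mxdot A B *: A).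
rewrite mxdotBl !mxdotBr !mxdotZl !mxdotZr (mxdotC _ _ B A) => H.
rewrite -subr_ge0 -(pmulr_rge0 _ Agt0); lra.
Qed.

Lemma mxdot_le_frob m n (A B : 'M[R]_(m, n)) : mxdot A B <= frob A * frob B.
Proof.
apply: le_trans (ler_norm _) _.
rewrite -ler_sqr ?nnegrE ?normr_ge0 ?mulr_ge0 ?frob_ge0 //.
by rewrite real_normK ?num_real // exprMn !frob_sqr mxdot_CS.
Qed.

Lemma quad_mxdot n (A : 'M[R]_n) (v : 'cV[R]_n) :
  (v^T *m A *m v) 0 0 = mxdot v (A *m v).
Proof. by rewrite /mxdot mulmxA [in RHS]/mxtrace big_ord1. Qed.

Lemma psd_quad n (A : 'M[R]_n) (v : 'cV[R]_n) : psd A -> 0 <= mxdot v (A *m v).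
Proof. by case=> _ /(_ v); rewrite quad_mxdot. Qed.

Lemma mxdot_col m n (A B : 'M[R]_(m, n)) :
  mxdot A B = \sum_j mxdot (col j A) (col j B).
Proof.
rewrite mxdotE exchange_big; apply: eq_bigr => j _; rewrite mxdotE.
by apply: eq_bigr => i _; rewrite big_ord1 !mxE.
Qed.

Lemma psd_sandwich n p (A : 'M[R]_n) (B : 'M[R]_(n, p)) :
  psd A -> 0 <= mxdot B (A *m B).
Proof.
move=> psdA; rewrite mxdot_col; apply: sumr_ge0 => j _.
by rewrite [col j (A *m B)]colE -mulmxA -colE psd_quad.
Qed.

(* [W - W^2 = W (1 - W) W + (1 - W) W (1 - W)] *)
Lemma mxdot_contraction n (W : 'M[R]_n) :
  psd W -> psd (1%:M - W) -> mxdot W W <= \tr W.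
Proof.
move=> psdW psdW'; have [symW _] := psdW; have [symW' _] := psdW'.
have := addr_ge0 (psd_sandwich _ _ _ W psdW') (psd_sandwich _ _ _ (1%:M - W) psdW).
rewrite /mxdot symW symW' -linearD /= => H.
rewrite -subr_ge0 -linearB /=; congr (0 <= \tr _): H.
rewrite !(mulmxBl, mulmxBr, mul1mx, mulmx1, mulmxA).
by rewrite addrC subrK.
Qed.

Lemma psd_gram m n (B : 'M[R]_(m, n)) : psd (B^T *m B).
Proof.
split=> [|v]; first by rewrite trmx_mul trmxK.
by rewrite quad_mxdot -mulmxA -mxdot_mull mxdot_ge0.
Qed.

Section OrthonormalColumns.
Context (d k : nat) (V : 'M[R]_(d, k)).
Hypothesis V1 : V^T *m V = 1%:M.

Lemma mxdot_proj (A : 'M[R]_d) : mxdot (V *m V^T) A = mxdot V (A *m V).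
Proof. by rewrite mxdot_mulr trmxK. Qed.

Lemma mxtrace_proj : \tr (V *m V^T) = k%:R.
Proof. by rewrite mxtrace_mulC V1 mxtrace1. Qed.

Lemma proj_sym : (V *m V^T)^T = V *m V^T.
Proof. by rewrite trmx_mul trmxK. Qed.

Lemma proj_idem : V *m V^T *m (V *m V^T) = V *m V^T.
Proof. by rewrite mulmxA -(mulmxA V) V1 mulmx1. Qed.

Lemma mxdot_proj_self : mxdot (V *m V^T) (V *m V^T) = k%:R.
Proof. by rewrite /mxdot proj_sym proj_idem mxtrace_proj. Qed.

Lemma psd_proj : psd (V *m V^T).
Proof. by have := psd_gram _ _ V^T; rewrite trmxK. Qed.

(** A symmetric idempotent is its own Gram matrix. *)
Lemma psd_proj_compl : psd (1%:M - V *m V^T).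
Proof.
have := psd_gram _ _ (1%:M - V *m V^T).
rewrite [X in X *m _]linearB /= trmx1 proj_sym mulmxBl mul1mx mulmxBr mulmx1 proj_idem.
by rewrite subrr subr0.
Qed.

Lemma feasible_proj : feasible k (V *m V^T).
Proof. by split; [exact: psd_proj|split; [exact: psd_proj_compl|exact: mxtrace_proj]]. Qed.

End OrthonormalColumns.

Lemma psd_conj n p (A : 'M[R]_n) (B : 'M[R]_(n, p)) :
  psd A -> psd (B^T *m A *m B).
Proof.
move=> psdA; split=> [|v].
  by rewrite !trmx_mul trmxK (proj1 psdA) mulmxA.
by rewrite quad_mxdot -!mulmxA -mxdot_mull psd_quad.
Qed.

Lemma psd_diag n (A : 'M[R]_n) i : psd A -> 0 <= A i i.
Proof.
case=> _ /(_ (delta_mx i 0)); rewrite trmx_delta -rowE -colE !mxE //.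
Qed.

(** * Reflections as test matrices for a maximal trace *)

Definition householder n (v : 'cV[R]_n) : 'M[R]_n :=
  1%:M - (2 / mxdot v v) *: (v *m v^T).

Lemma householder_sym n (v : 'cV[R]_n) : (householder n v)^T = householder n v.
Proof. by rewrite /householder linearB linearZ /= trmx1 trmx_mul trmxK. Qed.

Lemma col_mulT n (v w : 'cV[R]_n) : v^T *m w = (mxdot v w)%:M.
Proof. by rewrite [LHS]mx11_scalar /mxdot /mxtrace big_ord1. Qed.

Lemma householder_orth n (v : 'cV[R]_n) : v != 0 -> orthogonal_mx (householder n v).
Proof.
move=> v0; have vv0 : mxdot v v != 0.
  by apply: contra_neq v0 => v0; apply: mxdot_eq0; rewrite v0.
rewrite /orthogonal_mx householder_sym /householder.
rewrite mulmxBl mul1mx mulmxBr mulmx1 -scalemxAl -scalemxAr scalerA.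
rewrite mulmxA -(mulmxA v) col_mulT mul_mx_scalar -scalemxAl scalerA.
rewrite -addrA -opprD -[RHS]subr0; congr (_ - _).
rewrite -scalerBl -scalerDl.
rewrite [X in X *: _](_ : _ = 0) ?scale0r //; field; exact: vv0.
Qed.

Lemma householder_mul n (v w : 'cV[R]_n) :
  householder n v *m householder n w =
  1%:M - (2 / mxdot v v) *: (v *m v^T) - (2 / mxdot w w) *: (w *m w^T)
  + (4 * mxdot v w / (mxdot v v * mxdot w w)) *: (v *m w^T).
Proof.
rewrite /householder mulmxBl mul1mx mulmxBr mulmx1 -scalemxAl -scalemxAr scalerA.
rewrite mulmxA -(mulmxA v) col_mulT mul_mx_scalar -scalemxAl scalerA.
rewrite opprB addrA [LHS]addrAC; congr (_ + _).
  by rewrite addrAC.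
by congr (_ *: _); rewrite invfM; ring.
Qed.

Lemma mxdot_rank1 n (v w : 'cV[R]_n) (S : 'M[R]_n) :
  mxdot (v *m w^T) S = mxdot v (S *m w).
Proof. by rewrite mxdot_mulr trmxK. Qed.

Lemma mxdot1 n (S : 'M[R]_n) : mxdot 1%:M S = \tr S.
Proof. by rewrite /mxdot trmx1 mul1mx. Qed.

Lemma mxdot_delta n (i j : 'I_n) (S : 'M[R]_n) :
  mxdot (delta_mx i 0 : 'cV_n) (S *m delta_mx j 0) = S i j.
Proof.
rewrite /mxdot trmx_delta -colE -rowE /mxtrace big_ord1 !mxE //.
Qed.

(* Testing the maximality of the trace against one reflection gives
   positivity, against the products of two reflections symmetry. *)
Lemma trace_max_psd n (S : 'M[R]_n) :
  (forall Q : 'M[R]_n, orthogonal_mx Q -> mxdot Q S <= \tr S) -> psd S.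
Proof.
move=> Smax; split.
  (* The reflections along [e_i] and [e_i + t e_j] compose to a rotation of their plane by an angle
     of order [t]. The antisymmetric part of [S] enters at first order in [t], the diagonal only at
     second order. *)
  have asym (i j : 'I_n) (t : R) : i != j ->
      t * (S i j - S j i) <= t ^+ 2 * (S i i + S j j).
    move=> neq_ij; pose v : 'cV[R]_n := delta_mx i 0.
    pose w : 'cV[R]_n := v + t *: delta_mx j 0.
    have deltaE (a b : 'I_n) :
        mxdot (delta_mx a 0 : 'cV[R]_n) (delta_mx b 0) = (a == b)%:R.
      by rewrite -[X in mxdot _ X]mul1mx mxdot_delta mxE.
    have vv : mxdot v v = 1 by rewrite deltaE eqxx.
    have vw : mxdot v w = 1.
      by rewrite /w mxdotDr mxdotZr !deltaE eqxx (negbTE neq_ij) mulr0 addr0.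
    have ww : mxdot w w = 1 + t ^+ 2.
      rewrite {1}/w mxdotDl mxdotZl vw /w mxdotDr mxdotZr !deltaE eqxx.
      by rewrite eq_sym (negbTE neq_ij) add0r mulr1.
    have t2 : 0 < 1 + t ^+ 2 by rewrite ltr_pwDl // sqr_ge0.
    have v0 : v != 0.
      by apply/eqP => v0; move: vv; rewrite v0 /mxdot mulmx0 mxtrace0 => /eqP;
        rewrite eq_sym oner_eq0.
    have w0 : w != 0.
      by apply/eqP => w0; move: t2; rewrite -ww w0 /mxdot mulmx0 mxtrace0 ltxx.
    have orth : orthogonal_mx (householder n v *m householder n w).
      rewrite /orthogonal_mx trmx_mul mulmxA -(mulmxA _ _ (householder n v)).
      by rewrite householder_orth // mulmx1 householder_orth.
    have := Smax _ orth; rewrite householder_mul mxdotDl !mxdotBl !mxdotZl.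
    rewrite !mxdot_rank1 mxdot1 vv vw ww mul1r mulr1.
    rewrite /w mulmxDr !mxdotDl !mxdotDr -scalemxAr !mxdotZl !mxdotZr.
    rewrite !mxdot_delta -addrA -addrA gerDl addrA !divr1 => H.
    have : 2 * (1 + t ^+ 2) * (- (2 * S i i) - 2 / (1 + t ^+ 2) *
        (S i i + t * S i j + (t * S j i + t * (t * S j j)))
        + 4 / (1 + t ^+ 2) * (S i i + t * S i j)) <= 0.
      by apply: mulr_ge0_le0 => //; rewrite mulr_ge0 // ltW.
    rewrite (_ : 2 * (1 + t ^+ 2) * _ = 4 * (t * (S i j - S j i) -
       t ^+ 2 * (S i i + S j j))); last by field; rewrite gt_eqF.
    by rewrite pmulr_rle0 // subr_le0.
  have le_sym (i j : 'I_n) : S i j <= S j i.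
    have [->//|neq_ij] := eqVneq i j.
    rewrite leNgt; apply/negP; rewrite -subr_gt0 => a0.
    set a := S i j - S j i in a0; set c := S i i + S j j.
    have c1 : 0 < 1 + `|c| by rewrite ltr_pwDl.
    (* For this [t] the inequality reads [a <= a c / (1 + |c|)], absurd for [a > 0]. *)
    have := asym i j (a / (1 + `|c|)) neq_ij; rewrite -/a -/c.
    rewrite expr2 -[leRHS]mulrA ler_pM2l ?divr_gt0 // mulrAC ler_pdivlMr //.
    by rewrite ler_pM2l //; have := ler_norm c; lra.
  by apply/matrixP => i j; rewrite mxE; apply/eqP; rewrite eq_le !le_sym.
move=> v; rewrite quad_mxdot.
have [->|v0] := eqVneq v 0; first by rewrite mulmx0 /mxdot mulmx0 mxtrace0.
have vv : 0 < mxdot v v.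
  rewrite lt_def mxdot_ge0 andbT; apply: contra_neq v0 => v0.
  by apply: mxdot_eq0; rewrite v0.
have := Smax _ (householder_orth _ _ v0).
rewrite /householder mxdotBl mxdotZl mxdot_rank1 mxdot1.
rewrite lerBlDr lerDl pmulr_rge0 // divr_gt0 //.
Qed.

(** * Orthogonal Procrustes *)

Lemma continuous_big_sum (K : realType) (T : topologicalType) (I : Type)
    (r : seq I) (f : I -> T -> K) :
  (forall i, continuous (f i)) -> continuous (fun x => \sum_(i <- r) f i x).
Proof.
move=> fc; elim: r => [|i r IHr] x.
  rewrite (_ : (fun _ => _) = cst 0); first exact: cst_continuous.
  by apply/funext => y; rewrite big_nil.
rewrite (_ : (fun _ => _) = (fun y => f i y + \sum_(j <- r) f j y)).
  by apply: continuousD; [exact: fc|exact: IHr].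
by apply/funext => y; rewrite big_cons.
Qed.

(** The orthogonal group is closed and bounded, hence compact, and the trace is continuous. Matrices
    are flattened to row vectors to apply Heine-Borel; [gram p] is the entry [p] of the Gram
    matrix. *)
Lemma orthogonal_trace_max (K : realType) (n : nat) (B : 'M[K]_n) :
  exists O : 'M[K]_n, O^T *m O = 1%:M /\
    forall Q : 'M[K]_n, Q^T *m Q = 1%:M -> \tr (Q^T *m B) <= \tr (O^T *m B).
Proof.
pose gram (p : 'I_n * 'I_n) (v : 'rV[K]_(n * n)) :=
  \sum_(l < n) v 0 (mxvec_index l p.1) * v 0 (mxvec_index l p.2).
pose A : set 'rV[K]_(n * n) :=
  \bigcap_(p in setT) (gram p @^-1` [set (p.1 == p.2)%:R]).
have AE v : A v <-> (vec_mx v)^T *m vec_mx v = 1%:M.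
  split=> [Av|/matrixP vv].
    apply/matrixP => i j; have := Av (i, j) I; rewrite /gram /= !mxE => <-.
    by apply: eq_bigr => l _; rewrite !mxE.
  move=> [i j] _; have := vv i j; rewrite /gram /= !mxE => <-.
  by apply: eq_bigr => l _; rewrite !mxE.
have coordc (i : 'I_(n * n)) : continuous (fun v : 'rV[K]_(n * n) => v 0 i).
  exact: coord_continuous.
have Aclosed : closed A.
  apply: closed_bigI => p _; apply: preimage_closed; last exact: closed_eq.
  move=> v _; apply: continuous_big_sum => l w.
  by apply: continuousM; exact: coordc.
have Abnd : bounded_set A.
  exists 1; split; first exact: num_real.
  move=> x x1 v /AE/matrixP vv; apply: le_trans (ltW x1).
  (* The norm is the maximum norm, and an entry of a unit column has modulus at most 1. *)
  rewrite [leLHS]/Num.norm /= mx_normrE; apply/bigmax_leP; split => // -[i j] _ /=.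
  rewrite (ord1 i); case/mxvec_indexP: j => a b.
  have := vv b b; rewrite !mxE eqxx => v1.
  rewrite -[leRHS]sqrtr1 -sqrtr_sqr ler_sqrt // -[leRHS]/(true%:R) -v1 (bigD1 a) //= !mxE -expr2.
  by rewrite lerDl; apply: sumr_ge0 => l _; rewrite !mxE -expr2 sqr_ge0.
have Acompact := bounded_closed_compact Abnd Aclosed.
have A0 : A !=set0.
  by exists (mxvec 1%:M); apply/AE; rewrite mxvecK trmx1 mulmx1.
pose f (v : 'rV[K]_(n * n)) := \tr ((vec_mx v)^T *m B).
have fE : f = fun v => \sum_i \sum_j v 0 (mxvec_index j i) * B j i.
  apply/funext => v; rewrite /f /mxtrace; apply: eq_bigr => i _.
  by rewrite mxE; apply: eq_bigr => j _; rewrite !mxE.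
have fc : continuous f.
  rewrite fE; apply: continuous_big_sum => i.
  apply: continuous_big_sum => j w.
  by apply: continuousM; [exact: coordc|exact: cst_continuous].
have [c cA cmax] := compact_EVT_max A0 Acompact (continuous_subspaceT fc).
exists (vec_mx c); split; first by apply/AE; exact: set_mem.
move=> Q QQ; have := cmax (mxvec Q); rewrite /f mxvecK; apply.
by apply/mem_set/AE; rewrite mxvecK.
Qed.

(** By Cauchy-Schwarz [<v,Sv>^2 <= |v|^2 |Sv|^2 <= |v|^4]. *)
Lemma psd_contraction n (S : 'M[R]_n) :
  psd S -> psd (1%:M - S^T *m S) -> psd (1%:M - S).
Proof.
move=> psdS [_ StS]; split; first by rewrite linearB /= trmx1 (proj1 psdS).
move=> v; rewrite quad_mxdot mulmxBl mul1mx mxdotBr subr_ge0.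
have := StS v; rewrite quad_mxdot mulmxBl mul1mx mxdotBr subr_ge0.
rewrite -mulmxA -mxdot_mull => Sv.
have := mxdot_CS _ _ v (S *m v) => CS.
rewrite -ler_sqr ?nnegrE ?mxdot_ge0 ?psd_quad // (le_trans CS) // expr2.
by rewrite ler_wpM2l ?mxdot_ge0.
Qed.

(** A variational polar decomposition: for the [Om] that maximizes the trace of [Om^T B], the factor
    [S = Om^T B] is positive semidefinite. It is also a contraction, so [tr (S^2) <= tr S], which is
    the claim. *)
Lemma contraction_polar n (B : 'M[R]_n) : psd (1%:M - B^T *m B) ->
  exists O : 'M[R]_n, orthogonal_mx O /\ mxdot B B <= mxdot O B.
Proof.
move=> psdB; have [Om [OO Omax]] := orthogonal_trace_max R n B.
exists Om; split=> //; have OOT : Om *m Om^T = 1%:M by exact: mulmx1C.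
pose S := Om^T *m B.
have StS : S^T *m S = B^T *m B.
  by rewrite /S trmx_mul trmxK -mulmxA (mulmxA Om) OOT mul1mx.
have psdS : psd S.
  (* Testing [S] against [Q] is testing [B] against the orthogonal matrix [Om Q]. *)
  apply: trace_max_psd => Q QQ; rewrite /mxdot /S mulmxA -trmx_mul.
  by apply: Omax; rewrite trmx_mul -mulmxA (mulmxA _ Om) OO mul1mx.
have := mxdot_contraction _ _ psdS (psd_contraction _ _ psdS _).
by rewrite StS => /(_ psdB); rewrite {1}/mxdot StS.
Qed.

(** With [B = W^T V], the squared norms are [2k - 2 <O,B>] and [2k - 2 <B,B>], and [B] is a
    contraction. *)
Lemma orthogonal_procrustes (d k : nat) (V W : 'M[R]_(d, k)) :
  V^T *m V = 1%:M -> W^T *m W = 1%:M ->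
  exists O : 'M[R]_k, orthogonal_mx O /\
    frob (V - W *m O) <= frob (V *m V^T - W *m W^T).
Proof.
move=> VV WW; pose B := W^T *m V.
have [|Om [OO BO]] := contraction_polar _ B.
  have := psd_conj _ _ _ V (psd_proj_compl _ _ _ WW).
  by rewrite mulmxBr mulmx1 mulmxBl VV /B trmx_mul trmxK !mulmxA.
exists Om; split=> //.
rewrite -ler_sqr ?nnegrE ?frob_ge0 // !frob_sqr !mxdotBl !mxdotBr.
rewrite !mxdot_proj_self // (mxdotC _ _ (W *m W^T)) (mxdotC _ _ (W *m Om)).
have -> : mxdot V V = k%:R by rewrite /mxdot VV mxtrace1.
have -> : mxdot (W *m Om) (W *m Om) = k%:R.
  by rewrite mxdot_mull mulmxA WW mul1mx /mxdot OO mxtrace1.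
have -> : mxdot V (W *m Om) = mxdot Om B by rewrite mxdotC mxdot_mull.
have -> : mxdot (V *m V^T) (W *m W^T) = mxdot B B.
  by rewrite mxdot_proj mxdotC -mulmxA mxdot_mull.
lra.
Qed.

(** * Eigenprojections and the deterministic bound *)

Section TopEigenspace.
Context (d k : nat) (A : 'M[R]_d) (lam : nat -> R).
Hypothesis k_bounds : (0 < k < d)%N.
Hypothesis A_lam : sorted_eigenvalues A lam.

(** Eigenvalues are indexed from 0, so this is the k-th largest minus the next one. *)
Let gap := lam k.-1 - lam k.

Lemma top_eigvecs_mxdot (V : 'M[R]_(d, k)) : top_eigvecs A lam V ->
  mxdot A (V *m V^T) = \sum_(i < k) lam i.
Proof.
case=> VV AV; rewrite mxdotC mxdot_proj mxdot_col; apply: eq_bigr => i _.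
rewrite [col i (A *m V)]colE -mulmxA -colE AV mxdotZr.
have /matrixP/(_ i i) := VV; rewrite mxE [RHS]mxE eqxx => Vi.
rewrite (_ : mxdot _ _ = 1) ?mulr1 // mxdotE -[RHS]Vi.
by apply: eq_bigr => j _; rewrite big_ord1 !mxE.
Qed.

Lemma ky_fan_gap : exists V : 'M[R]_(d, k), top_eigvecs A lam V /\
  forall W, feasible k W ->
    0 <= k%:R - mxdot (V *m V^T) W /\
    gap * (k%:R - mxdot (V *m V^T) W) <= \sum_(i < k) lam i - mxdot A W.
Proof.
have /andP[k0 kd] := k_bounds.
have [lam_mono [U [UU AE]]] := A_lam.
pose w (W : 'M[R]_d) (i : 'I_d) := (U^T *m W *m U) i i.
have kd' : (k <= d)%N by exact: ltnW.
pose V : 'M[R]_(d, k) := \matrix_(i, j) U i (widen_ord kd' j).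
have VU (i : 'I_k) : col i V = col (widen_ord kd' i) U.
  by apply/matrixP => a b; rewrite !mxE.
have Asym : A^T = A by rewrite AE !trmx_mul trmxK tr_diag_mx mulmxA.
have AW W : mxdot A W = \sum_(i < d) lam i * w W i.
  rewrite /mxdot Asym AE -mulmxA mxtrace_mulC mulmxA mxtrace_mulC mulmxA.
  rewrite -!mulmxA mul_diag_mx /mxtrace; apply: eq_bigr => i _.
  by rewrite mxE [X in X * _]mxE /w mulmxA.
have VW W : mxdot (V *m V^T) W = \sum_(i < d | (i < k)%N) w W i.
  rewrite mxdot_proj mxdot_col (big_ord_narrow kd'); apply: eq_bigr => i _.
  rewrite [col i (W *m V)]colE -mulmxA -colE VU /w -mxdot_delta colE mxdot_mull.
  by rewrite !mulmxA.
exists V; split.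
  split.
    apply/matrixP => i j; have /matrixP/(_ (widen_ord kd' i) (widen_ord kd' j)) := UU.
    rewrite !mxE => <-; by apply: eq_bigr => l _; rewrite !mxE.
  move=> i; rewrite VU AE -!mulmxA colE (mulmxA U^T) UU mul1mx.
  rewrite mul_diag_mx [RHS]scalemxAr; congr (U *m _).
  apply/matrixP => a b; rewrite !mxE (ord1 b) eqxx andbT.
  by case: eqVneq => [->|]; rewrite ?mulr1 ?mulr0.
move=> W [psdW [psdW' trW]].
have w0 i : 0 <= w W i by apply: psd_diag; exact: psd_conj.
have w1 i : w W i <= 1.
  have := psd_diag _ _ i (psd_conj _ _ _ U psdW').
  by rewrite mulmxBr mulmx1 mulmxBl UU mxE [X in X + _]mxE eqxx [X in _ + X]mxE subr_ge0.
have sumw : \sum_(i < d) w W i = k%:R.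
  by rewrite -trW -[in RHS](mulmx1 W) -(mulmx1C UU) mulmxA mxtrace_mulC mulmxA.
have lamk : \sum_(i < k) lam i = \sum_(i < d | (i < k)%N) lam i.
  by rewrite (big_ord_narrow kd').
have card_k : \sum_(i < d | (i < k)%N) (1 : R) = k%:R.
  by rewrite (big_ord_narrow kd') sumr_const card_ord.
rewrite VW AW lamk; split.
  by rewrite subr_ge0 -card_k; apply: ler_sum => i _.
have lo : lam k.-1 * \sum_(i < d | (i < k)%N) (1 - w W i) <=
          \sum_(i < d | (i < k)%N) lam i * (1 - w W i).
  rewrite mulr_sumr; apply: ler_sum => i ik; rewrite ler_wpM2r ?subr_ge0 //.
  by apply: lam_mono; [rewrite -ltnS prednK|rewrite prednK // ltnW].
have hi : \sum_(i < d | ~~ (i < k)%N) lam i * w W i <=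
          lam k * \sum_(i < d | ~~ (i < k)%N) w W i.
  rewrite mulr_sumr; apply: ler_sum => i ik; rewrite ler_wpM2r //.
  by apply: lam_mono; rewrite // leqNgt.
move: lo; rewrite sumrB card_k.
have -> : \sum_(i < d | (i < k)%N) lam i * (1 - w W i) =
    \sum_(i < d | (i < k)%N) lam i - \sum_(i < d | (i < k)%N) lam i * w W i.
  by rewrite -sumrB; apply: eq_bigr => i _; rewrite mulrBr mulr1.
rewrite [X in _ -> _ <= _ - X](bigID (fun i : 'I_d => (i < k)%N)) /= => lo.
have splitw : \sum_(i < d | ~~ (i < k)%N) w W i =
    k%:R - \sum_(i < d | (i < k)%N) w W i.
  by rewrite -sumw [in RHS](bigID (fun i : 'I_d => (i < k)%N)) /= addrAC subrr add0r.
move: hi; rewrite splitw /gap; lra.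
Qed.

(** Sorting gives [gap >= 0], so the deficit in [ky_fan_gap] is nonnegative. This will be applied to
    [What], whose eigenvalues may be tied at rank [k]. *)
Lemma ky_fan (V W : 'M[R]_(d, k)) : top_eigvecs A lam V ->
  W^T *m W = 1%:M -> mxdot A (W *m W^T) <= mxdot A (V *m V^T).
Proof.
move=> VA WW; rewrite (top_eigvecs_mxdot _ VA).
have [V' [_ /(_ _ (feasible_proj _ _ _ WW))[ge0 H]]] := ky_fan_gap.
rewrite -subr_ge0; apply: le_trans H; rewrite mulr_ge0 // /gap subr_ge0.
have /andP[k0 kd] := k_bounds.
by case: A_lam => lam_mono _; apply: lam_mono => //; exact: leq_pred.
Qed.

(** Since [|W|^2 <= tr W = k], the squared distance [k - 2 <P,W> + |W|^2] is at most
    [2 (k - <P,W>)], which [ky_fan_gap] controls. *)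
Lemma top_projection_curvature (V : 'M[R]_(d, k)) (W : 'M[R]_d) :
  0 < gap -> top_eigvecs A lam V -> feasible k W ->
  gap / 2 * frob (V *m V^T - W) ^+ 2 <= mxdot A (V *m V^T - W).
Proof.
move=> gap0 VA FW; have VV := proj1 VA.
have [V' [[V'V' _] V'max]] := ky_fan_gap.
(* a positive gap makes the top eigenprojection unique *)
have PE : V' *m V'^T = V *m V^T.
  have [_] := V'max _ (feasible_proj _ _ _ VV).
  rewrite (top_eigvecs_mxdot _ VA) subrr pmulr_rle0 // => P0.
  apply/eqP; rewrite -subr_eq0; apply/eqP/mxdot_eq0.
  rewrite mxdotBl !mxdotBr !mxdot_proj_self // (mxdotC _ _ (V *m _)); lra.
have [_] := V'max _ FW; rewrite PE mxdotBr (top_eigvecs_mxdot _ VA).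
apply: le_trans; rewrite -mulrA ler_pM2l // frob_sqr mxdotBl !mxdotBr.
have [psdW [psdW' trW]] := FW; have := mxdot_contraction _ _ psdW psdW'.
rewrite mxdot_proj_self // (mxdotC _ _ W) trW; lra.
Qed.

End TopEigenspace.

Lemma frob_distC m n (A B : 'M[R]_(m, n)) : frob (A - B) = frob (B - A).
Proof.
rewrite /frob; congr Num.sqrt; apply: eq_bigr => i _; apply: eq_bigr => j _.
by rewrite !mxE -sqrrN opprB.
Qed.

(** With [P] and [P'] the projections of [V] and [V'], [|P - P'|^2 = 2 <P', P' - P>]. Ky Fan gives
    [<W, P' - P> <= 0], so [P'] may be replaced by [P' - W] on the left; Cauchy-Schwarz then allows
    cancelling one factor [|P - P'|]. *)
Lemma top_projection_perturb (d k : nat) (W : 'M[R]_d) (mu : nat -> R)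
    (V V' : 'M[R]_(d, k)) :
  (0 < k < d)%N -> sorted_eigenvalues W mu -> top_eigvecs W mu V ->
  V'^T *m V' = 1%:M ->
  frob (V *m V^T - V' *m V'^T) <= 2 * frob (V' *m V'^T - W).
Proof.
move=> kd Wmu VW VV'; have VV := proj1 VW.
have kf := ky_fan _ _ _ _ kd Wmu _ _ VW VV'.
have PP := mxdot_proj_self _ _ _ VV; have PP' := mxdot_proj_self _ _ _ VV'.
set P := V *m V^T in kf PP *; set P' := V' *m V'^T in kf PP' *.
have [->|x0] := eqVneq (frob (P - P')) 0; first by rewrite mulr_ge0 ?frob_ge0.
have {}x0 : 0 < frob (P - P') by rewrite lt_def x0 frob_ge0.
rewrite -(ler_pM2r x0) -expr2 -mulrA frob_sqr.
have := mxdot_le_frob _ _ (P' - W) (P' - P); rewrite (frob_distC _ _ P' P).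
rewrite !mxdotBl !mxdotBr PP PP' (mxdotC _ _ P' P); lra.
Qed.

(** * Sparse support and the error of the convex program *)

Section Support.
Context (d s : nat) (J : {pred 'I_d}).
Hypothesis cardJ : (#|J| <= s)%N.

Let Z : 'M[R]_d := \matrix_(i, j) ((i \in J) && (j \in J))%:R.

(** Cauchy-Schwarz against the indicator [Z] of the block, of Frobenius norm [#|J|]. *)
Lemma block_l1_frob (D : 'M[R]_d) :
  \sum_i \sum_j ((i \in J) && (j \in J))%:R * `|D i j| <= s%:R * frob D.
Proof.
pose E : 'M[R]_d := \matrix_(i, j) `|D i j|.
have -> : \sum_i \sum_j ((i \in J) && (j \in J))%:R * `|D i j| = mxdot Z E.
  by rewrite mxdotE; apply: eq_bigr => i _; apply: eq_bigr => j _; rewrite !mxE.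
have -> : frob D = frob E.
  rewrite /frob; congr Num.sqrt; apply: eq_bigr => i _; apply: eq_bigr => j _.
  by rewrite mxE real_normK // num_real.
apply: le_trans (mxdot_le_frob _ _ _ _) _; rewrite ler_wpM2r ?frob_ge0 //.
rewrite -ler_sqr ?nnegrE ?frob_ge0 // frob_sqr mxdotE.
have -> : \sum_i \sum_j Z i j * Z i j = #|J|%:R ^+ 2.
  have cardE : #|J|%:R = \sum_(i < d) (i \in J)%:R :> R.
    by rewrite -sum1_card big_mkcond natr_sum /=; apply: eq_bigr => i _; case: (i \in J).
  rewrite expr2 {1}cardE mulr_suml; apply: eq_bigr => i _.
  rewrite cardE mulr_sumr; apply: eq_bigr => j _; rewrite !mxE.
  by case: (i \in J); case: (j \in J); rewrite /= ?mulr1 ?mulr0.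
by rewrite ler_sqr ?nnegrE // ler_nat.
Qed.

End Support.

(** Entrywise accounting of [<A,D>]: inside the support block the noise and the penalty cost at most
    [(2/5 + 1) lambda |D i j|]. Outside it [P] vanishes and the penalty on [W] outweighs the noise.
    Curvature turns [7/5] into [14/5]. *)
Lemma sparse_pca_frob (d k s : nat) (lambda : R) (A S : 'M[R]_d)
    (lam : nat -> R) (V : 'M[R]_(d, k)) (W : 'M[R]_d) :
  (0 < k < d)%N -> sorted_eigenvalues A lam -> 0 < lam k.-1 - lam k ->
  top_eigvecs A lam V -> (#|[set j : 'I_d | row j V != 0%R]| <= s)%N ->
  0 <= lambda -> (forall i j, `|S i j - A i j| <= 2 / 5 * lambda) ->
  is_maximizer k lambda S W ->
  frob (V *m V^T - W) <= 14 / 5 / (lam k.-1 - lam k) * s%:R * lambda.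
Proof.
move=> kd Alam gap0 VA Vs lam0 dev [FW Wmax].
have curv := top_projection_curvature _ _ _ _ kd Alam _ _ gap0 VA FW.
have := Wmax _ (feasible_proj _ _ _ (proj1 VA)); rewrite /objective -!/(mxdot _ _).
set gap := lam k.-1 - lam k in gap0 curv *.
pose J := [pred j | row j V != 0].
have cardJ : (#|J| <= s)%N.
  apply: leq_trans Vs; apply: eq_leq; apply: eq_card => j.
  by rewrite inE; apply/idP/idP => ?; [exact/mem_set|exact/set_mem].
set P := V *m V^T in curv *; set D := P - W in curv * => maxP.
have P0 i j : ~~ ((i \in J) && (j \in J)) -> P i j = 0.
  rewrite !inE negb_and !negbK /P mxE => /orP[] /eqP/matrixP Vj.
    by apply: big1 => l _; have := Vj 0 l; rewrite !mxE => ->; rewrite mul0r.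
  by apply: big1 => l _; have := Vj 0 l; rewrite !mxE => ->; rewrite mulr0.
have : mxdot A D <= 7 / 5 * lambda * (s%:R * frob D).
  have -> : mxdot A D = mxdot (A - S) D + mxdot S D by rewrite -mxdotDl subrK.
  have : mxdot S D <= lambda * l1norm P - lambda * l1norm W.
    by rewrite mxdotBr (mxdotC _ _ S P) (mxdotC _ _ S W); lra.
  move=> SD; apply: le_trans (lerD (lexx _) SD) _.
  apply: le_trans (ler_wpM2l _ (block_l1_frob _ _ _ cardJ D)); last by lra.
  rewrite /l1norm mxdotE !mulr_sumr -sumrB -big_split /=; apply: ler_sum => i _.
  rewrite !mulr_sumr -sumrB -big_split /=; apply: ler_sum => j _.
  have ADle : (A - S) i j * D i j <= 2 / 5 * lambda * `|D i j|.
    apply: le_trans (ler_norm _) _; rewrite normrM ler_wpM2r //.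
    by rewrite !mxE distrC.
  have DE : D i j = P i j - W i j by rewrite /D mxE [X in _ + X]mxE.
  have [ij|nij] := boolP ((i \in J) && (j \in J)).
    have : lambda * `|P i j| <= lambda * (`|D i j| + `|W i j|).
      by rewrite ler_wpM2l // -[P i j](subrK (W i j)) -DE ler_normD.
    by move: ADle; rewrite mul1r; lra.
  have DW : `|D i j| = `|W i j| by rewrite DE P0 // sub0r normrN.
  move: ADle; rewrite DW P0 // normr0 !(mul0r, mulr0) add0r.
  have : 0 <= lambda * `|W i j| by rewrite mulr_ge0.
  lra.
move=> /(le_trans curv) {curv}.
have [->|x0] := eqVneq (frob D) 0.
  by move=> _; rewrite !mulr_ge0 // ?invr_ge0 ?ltW.
have {}x0 : 0 < frob D by rewrite lt_def x0 frob_ge0.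
rewrite expr2 !mulrA ler_pM2r // => H.
rewrite -(ler_pM2l gap0).
rewrite (_ : gap * (_ * _) = 14 / 5 * s%:R * lambda); last first.
  by field; rewrite gt_eqF.
lra.
Qed.

Lemma sparse_pca_deterministic (d k s : nat) (lambda : R) (A S : 'M[R]_d)
    (lam mu : nat -> R) (V Vhat : 'M[R]_(d, k)) (W : 'M[R]_d) :
  (0 < k < d)%N -> sorted_eigenvalues A lam -> 0 < lam k.-1 - lam k ->
  top_eigvecs A lam V -> (#|[set j : 'I_d | row j V != 0%R]| <= s)%N ->
  0 <= lambda -> (forall i j, `|S i j - A i j| <= 2 / 5 * lambda) ->
  is_maximizer k lambda S W -> sorted_eigenvalues W mu ->
  top_eigvecs W mu Vhat ->
  inf [set x | exists Om : 'M[R]_k, orthogonal_mx Om /\ x = frob (Vhat - V *m Om)]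
    <= 4 * Num.sqrt 2 / (lam k.-1 - lam k) * s%:R * lambda.
Proof.
move=> kd Alam gap0 VA Vs lam0 dev Wmax Wmu VhatW.
have [Om [OmO VO]] := orthogonal_procrustes _ _ _ _ (proj1 VhatW) (proj1 VA).
apply: (@le_trans _ _ (frob (Vhat - V *m Om))).
  (* A real infimum lies below the members of a set only once a lower bound is known; here it is
     0. *)
  apply: ge_inf; last by exists Om.
  by exists 0 => _ [Q [_ ->]]; exact: frob_ge0.
apply: le_trans VO _.
apply: le_trans (top_projection_perturb _ _ _ _ _ _ kd Wmu VhatW (proj1 VA)) _.
have := sparse_pca_frob _ _ _ _ _ _ _ _ _ kd Alam gap0 VA Vs lam0 dev Wmax.
rewrite -(ler_pM2l (ltr0Sn _ 1)) => /le_trans; apply.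
set c := (lam k.-1 - lam k)^-1 * s%:R * lambda.
have c0 : 0 <= c by rewrite /c !mulr_ge0 // invr_ge0 ltW.
(* The total constant is [2 * (14/5) = 4 * (7/5)], and [49/25 <= 2]. *)
have sqrt2 : 7 / 5 <= Num.sqrt 2 :> R.
  by rewrite -[leLHS]ger0_norm ?divr_ge0 // -sqrtr_sqr ler_sqrt //; lra.
rewrite (_ : 2 * _ = 4 * (7 / 5) * c); last by rewrite /c; field; rewrite gt_eqF.
rewrite [leRHS](_ : _ = 4 * Num.sqrt 2 * c); last by rewrite /c !mulrA.
by rewrite ler_wpM2r // ler_wpM2l.
Qed.

(** * Chernoff bound for finitely valued variables *)

Section FiniteRange.
Context (d0 : measure_display) (T : measurableType d0) (K : realType).
Context (P : probability T K) (C : finType) (kap : T -> C).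
Hypothesis mkap : forall c, measurable (kap @^-1` [set c]).

Definition mass (c : C) : K := fine (P (kap @^-1` [set c])).

Lemma massE c : (mass c)%:E = P (kap @^-1` [set c]).
Proof. by rewrite /mass fineK // fin_num_measure. Qed.

Lemma mass_ge0 c : 0 <= mass c.
Proof. exact: fine_ge0. Qed.

Lemma measurable_finite_preimage (D : set C) : measurable (kap @^-1` D).
Proof.
rewrite (_ : kap @^-1` D = \big[setU/set0]_(c | c \in D) (kap @^-1` [set c])).
  by apply: bigsetU_measurable => c _.
rewrite -bigcup_seq_cond; apply/seteqP; split => [w Dw|w [c /=]].
  by exists (kap w) => //=; rewrite mem_index_enum; exact: mem_set.
by move=> /andP[_ /set_mem Dc] ->.
Qed.

Lemma finite_rangeE (f : C -> K) w :
  f (kap w) = \sum_c f c * \1_(kap @^-1` [set c]) w.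
Proof.
rewrite (bigD1 (kap w)) //= big1 ?addr0 => [|c cw].
  by rewrite indicE mem_set // mulr1.
rewrite indicE memNset ?mulr0 //= => /esym/eqP; exact/negP.
Qed.

Lemma integrable_finite_range (f : C -> K) :
  P.-integrable setT (fun w => (f (kap w))%:E).
Proof.
rewrite (_ : (fun _ => _) =
    (fun w => \sum_c (f c)%:E * (\1_(kap @^-1` [set c]) w)%:E))%E.
  apply: integrable_sum => // c _; apply: integrableZl => //.
  by apply: integrable_indic => //; exact: fin_num_measure.
by apply/funext => w; rewrite finite_rangeE -sumEFin.
Qed.

Lemma integral_finite_range (f : C -> K) :
  (\int[P]_w (f (kap w))%:E)%E = (\sum_c f c * mass c)%:E.
Proof.
have intI c : P.-integrable setT (fun w => (\1_(kap @^-1` [set c]) w)%:E).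
  by apply: integrable_indic => //; exact: fin_num_measure.
under eq_integral do rewrite finite_rangeE -sumEFin.
under eq_integral do under eq_bigr do rewrite EFinM.
rewrite integral_sum // => [|c]; last by apply: integrableZl.
rewrite -sumEFin; apply: eq_bigr => c _.
by rewrite integralZl // integral_indic // setIT EFinM massE.
Qed.

Lemma prob_finite_range (D : set C) :
  P (kap @^-1` D) = (\sum_c \1_D c * mass c)%:E.
Proof.
rewrite -integral_finite_range -[in LHS](setIT (_ @^-1` _)).
by rewrite -integral_indic //; exact: measurable_finite_preimage.
Qed.

End FiniteRange.

Section Chernoff.
Context (d0 : measure_display) (T : measurableType d0) (K : realType).
Context (P : probability T K) (C : finType) (n : nat) (kap : 'I_n -> T -> C).
Context (p : C -> K).
Hypothesis mkap : forall i c, measurable (kap i @^-1` [set c]).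
Hypothesis kap_iid : forall c : {ffun 'I_n -> C},
  P [set w | forall i, kap i w = c i] = (\prod_(i < n) p (c i))%:E.

(** Gathers the sample into one variable with finitely many values, so that the one-variable lemmas
    apply to it. *)
Let joint w : {ffun 'I_n -> C} := [ffun i => kap i w].

Let joint_fiber (c : {ffun 'I_n -> C}) :
  joint @^-1` [set c] = [set w | forall i, kap i w = c i].
Proof.
apply/seteqP; split => w /=; first by move=> <- i; rewrite ffunE.
by move=> cw; apply/ffunP => i; rewrite ffunE.
Qed.

Let mjoint (c : {ffun 'I_n -> C}) : measurable (joint @^-1` [set c]).
Proof.
rewrite joint_fiber (_ : [set w | _] = \bigcap_(i in setT) (kap i @^-1` [set c i])).
  by apply: fin_bigcap_measurable => // i _; exact: mkap.
by apply/seteqP; split => [w H i _|w H i]; [exact: H|exact: (H i I)].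
Qed.

Lemma measurable_sum_gt (z : C -> K) (v : K) :
  measurable [set w | v < \sum_(i < n) z (kap i w)].
Proof.
rewrite (_ : [set w | _] = joint @^-1` [set c | v < \sum_(i < n) z (c i)]).
  exact: measurable_finite_preimage.
apply/seteqP; split => w /=; congr (_ < _); apply: eq_bigr => i _;
  by rewrite ffunE.
Qed.

(* Expanding the product of the exponential moments over cells replaces the
   independence of the exponentials by the product rule for the cells. *)
Lemma chernoff_finite_range (z : C -> K) (v b : K) :
  (forall c, 0 <= p c) -> \sum_c p c * expR (z c) <= expR b ->
  (P [set w | (v < \sum_(i < n) z (kap i w))%R] <= (expR (n%:R * b - v))%:E)%E.
Proof.
move=> p0 mgf; rewrite (_ : [set w | _] =
    joint @^-1` [set c | v < \sum_(i < n) z (c i)]); last first.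
  apply/seteqP; split => w /=; congr (_ < _); apply: eq_bigr => i _;
    by rewrite ffunE.
rewrite prob_finite_range // lee_fin.
apply: (@le_trans _ _ (expR (- v) * \prod_(i < n) \sum_c p c * expR (z c))).
  rewrite bigA_distr_bigA mulr_sumr; apply: ler_sum => c _ /=.
  have -> : mass _ _ _ P _ joint c = \prod_(i < n) p (c i).
    by apply: EFin_inj; rewrite massE // joint_fiber kap_iid.
  rewrite big_split /= mulrCA mulrC ler_wpM2l ?prodr_ge0 //.
  rewrite -expR_sum -exp.expRD indicE.
  (* Markov's inequality pointwise: the indicator of a sum above [v] is at most the exponential of
     the sum minus [v]. *)
  case: (boolP (_ \in _)) => [/set_mem /= vc|_]; last exact: expR_ge0.
  by rewrite -[leLHS]exp.expR0 ler_expR addrC subr_ge0 ltW.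
rewrite addrC exp.expRD ler_wpM2l ?expR_ge0 // mulrC expRM_natr.
rewrite prodr_const card_ord; apply: lerXn2r => //; rewrite nnegrE ?expR_ge0 //.
by apply: sumr_ge0 => c _; rewrite mulr_ge0 ?expR_ge0.
Qed.

End Chernoff.

(** Inverting and squaring [1 - x/2 <= exp (-x/2)] gives [exp x <= (1 - x/2)^-2]; the rest is a
    polynomial inequality whose factors are nonnegative for [x <= 1]. *)
Lemma expR_le_quadratic (K : realType) (x : K) :
  x <= 1 -> expR x <= 1 + x + 2 * x ^+ 2.
Proof.
move=> x1; have h : 0 < 1 - x / 2 by lra.
have e1 : 1 - x / 2 <= expR (- (x / 2)).
  by apply: le_trans (expR_ge1Dx _); lra.
have e2 : expR (x / 2) <= (1 - x / 2)^-1.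
  by rewrite -[x / 2]opprK expRN lef_pV2 ?posrE ?expR_gt0 // opprK.
rewrite [X in expR X](_ : _ = x / 2 + x / 2); last by lra.
rewrite exp.expRD.
apply: (@le_trans _ _ ((1 - x / 2)^-1 * (1 - x / 2)^-1)).
  by apply: ler_pM; rewrite ?expR_ge0.
rewrite -invfM -div1r ler_pdivrMr ?mulr_gt0 //.
rewrite -subr_ge0 (_ : _ - _ = x ^+ 2 / 4 * ((1 - x) * (5 - 2 * x))); last by field.
by apply: mulr_ge0; [rewrite divr_ge0 ?sqr_ge0|apply: mulr_ge0; lra].
Qed.

(** * Truncation *)

Definition clip (K : realType) (tau x : K) : K := Num.sg x * Num.min `|x| tau.
Arguments clip {K}.

Section Clip.
Context (K : realType) (tau : K).
Hypothesis tau0 : 0 < tau.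
Implicit Types x y : K.

Lemma norm_clip x : `|clip tau x| = Num.min `|x| tau.
Proof.
rewrite /clip normrM normr_sg (ger0_norm (_ : 0 <= Num.min _ _)).
  have [->|x0] := eqVneq x 0; last by rewrite mul1r.
  by rewrite normr0 mul0r min_l // ltW.
by rewrite le_min normr_ge0 ltW.
Qed.

Lemma clip_id x : `|x| <= tau -> clip tau x = x.
Proof. by move=> xt; rewrite /clip min_l // -numEsg. Qed.

(** Either both arguments are left unchanged, or one exceeds [tau] and [tau^2 <= x^2 + y^2]. In the
    latter case the change is at most [|x y|], and [|x y| (x^2 + y^2) <= x^4 + y^4]. *)
Lemma clip_mul_bias x y :
  `|x * y - clip tau x * clip tau y| <= (x ^+ 4 + y ^+ 4) / tau ^+ 2.
Proof.
have x4 : x ^+ 4 = `|x| ^+ 4 by rewrite -normrX ger0_norm // exprn_even_ge0.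
have y4 : y ^+ 4 = `|y| ^+ 4 by rewrite -normrX ger0_norm // exprn_even_ge0.
rewrite ler_pdivlMr ?exprn_gt0 // x4 y4.
have [[xt yt]|big_xy] := pselect (`|x| <= tau /\ `|y| <= tau).
  by rewrite !clip_id // subrr normr0 mul0r addr_ge0 ?exprn_ge0.
have D : `|x * y - clip tau x * clip tau y| <= `|x| * `|y|.
  rewrite {1}(numEsg x) {1}(numEsg y) /clip.
  rewrite (_ : _ - _ = (Num.sg x * Num.sg y) *
    (`|x| * `|y| - Num.min `|x| tau * Num.min `|y| tau)); last by ring.
  have m1 : Num.min `|x| tau * Num.min `|y| tau <= `|x| * `|y|.
    by apply: ler_pM; rewrite ?le_min ?normr_ge0 ?ge_min ?lexx //= ltW.
  rewrite normrM (ger0_norm (_ : 0 <= _ - _)) ?subr_ge0 //.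
  rewrite -[leRHS]mul1r; apply: ler_pM => //; rewrite ?subr_ge0 //.
    by rewrite normrM !normr_sg -natrM lern1; case: (x != 0); case: (y != 0).
  by rewrite lerBlDr lerDl mulr_ge0 // le_min normr_ge0 ltW.
apply: (@le_trans _ _ (`|x| * `|y| * (`|x| ^+ 2 + `|y| ^+ 2))).
  apply: ler_pM; rewrite ?sqr_ge0 //.
  have tsq z : tau < `|z| -> tau ^+ 2 <= `|z| ^+ 2.
    by move=> tz; rewrite ler_sqr ?nnegrE ?normr_ge0 ?ltW.
  have [xt|/tsq xt] := leP `|x| tau; last by rewrite (le_trans xt) // lerDl sqr_ge0.
  have [yt|/tsq yt] := leP `|y| tau; last by rewrite (le_trans yt) // lerDr sqr_ge0.
  by case: big_xy.
rewrite -subr_ge0 (_ : _ - _ = (`|x| - `|y|) ^+ 2 *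
  (`|x| ^+ 2 + `|x| * `|y| + `|y| ^+ 2)); last by ring.
by rewrite mulr_ge0 ?sqr_ge0 // !addr_ge0 ?sqr_ge0 ?mulr_ge0.
Qed.

(** Keeps the sign and rounds the modulus down to a multiple of [eta]. Rounding toward 0 keeps the
    values dominated by the clipped ones, so moment bounds are inherited. *)
Lemma clip_grid (eta : K) : 0 < eta ->
  exists (C : finType) (kap : K -> C) (v : C -> K),
    (forall c, measurable (kap @^-1` [set c] : set (measurableTypeR K))) /\
    (forall c, `|v c| <= tau) /\
    forall x, `|v (kap x)| <= `|clip tau x| /\ `|clip tau x - v (kap x)| <= eta.
Proof.
move=> eta0; pose N := Num.truncn (tau / eta).
pose m x := Num.min `|x| tau / eta.
have m0 x : 0 <= m x by rewrite divr_ge0 ?(ltW eta0) // le_min normr_ge0 ltW.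
have mN x : (Num.truncn (m x) < N.+1)%N.
  by rewrite ltnS le_truncn // ler_pM2r ?invr_gt0 // ge_min lexx orbT.
pose kap x : bool * 'I_N.+1 := (0 <= x, inord (Num.truncn (m x))).
pose v (c : bool * 'I_N.+1) : K := (-1) ^+ (~~ c.1) * (c.2%:R * eta).
exists (bool * 'I_N.+1)%type, kap, v; split; last split.
  move=> [b i].
  have -> : kap @^-1` [set (b, i)] =
      [set x | (0 <= x) = b] `&` (m @^-1` `[i%:R, i.+1%:R[).
    apply/seteqP; split => x; rewrite /kap /= in_itv /=.
      move=> [<- <-]; rewrite inordK //; split=> //; exact: truncn_itv.
    move=> [-> /truncn_def ->]; congr (_, _); exact: inord_val.
  apply: measurableI.
    case: b.
      rewrite (_ : [set x | _] = `[0, +oo[%classic).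
        exact: measurable_itv.
      by apply/seteqP; split => x /=; rewrite in_itv /= andbT.
    rewrite (_ : [set x | _] = `]-oo, 0[%classic).
      exact: measurable_itv.
    apply/seteqP; split => x /=; rewrite in_itv /=; first by move/negbT; rewrite -ltNge.
    by rewrite ltNge => /negbTE.
  rewrite -[X in measurable X]setTI.
  have mm : measurable_fun setT (m : measurableTypeR K -> measurableTypeR K).
    apply: measurable_funM => //; apply: measurable_minr => //.
  exact: (mm measurableT _ (measurable_itv _)).
  (* The bound is proved for every cell, attained or not, because the exponential moments are sums
     over all cells. *)
  move=> [b i]; rewrite /v /= normrM normrX normrN1 expr1n mul1r.
  rewrite ger0_norm ?mulr_ge0 ?(ltW eta0) // -ler_pdivlMr //.
  apply: le_trans (_ : N%:R <= _); first by rewrite ler_nat -ltnS.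
  by have /andP[] := truncn_itv (ltW (divr_gt0 tau0 eta0)).
move=> x; have /andP[lo hi] := truncn_itv (m0 x).
have vE : v (kap x) = (-1) ^+ (~~ (0 <= x)) * ((Num.truncn (m x))%:R * eta).
  by rewrite /v /kap /= inordK.
have mE : m x * eta = Num.min `|x| tau by rewrite /m divfK ?gt_eqF.
have clipE : clip tau x = (-1) ^+ (~~ (0 <= x)) * (m x * eta).
  rewrite mE /clip; have [x0|x0] := lerP 0 x; last by rewrite ltr0_sg.
  move: x0; rewrite le_eqVlt => /orP[/eqP <-|x0]; last by rewrite gtr0_sg.
  by rewrite normr0 min_l ?mulr0 // ltW.
move: lo hi; rewrite clipE vE; move: (m x) (m0 x) => y y0 lo hi.
rewrite -mulrBr !normrM normrX normrN1 expr1n !mul1r -mulrBl normrM.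
rewrite !normr_nat (gtr0_norm eta0) (ger0_norm y0); split.
  by rewrite ler_wpM2r // ltW.
rewrite ger0_norm ?subr_ge0 // -[leRHS]mul1r ler_wpM2r ?(ltW eta0) //.
by move: hi; rewrite -natr1; lra.
Qed.

(** The three bounds serve, in order, the variance, the passage back to the unrounded sample, and
    the bias. The second telescopes the product, the third adds [clip_mul_bias]. *)
Lemma quantized_mul_bounds (q : K -> K) (eta x y : K) :
  (forall x, `|q x| <= `|clip tau x|) ->
  (forall x, `|clip tau x - q x| <= eta) ->
  [/\ `|q x * q y| <= `|x * y|,
      `|clip tau x * clip tau y - q x * q y| <= 2 * tau * eta &
      `|x * y - q x * q y| <= (`|x| ^+ 4 + `|y| ^+ 4) / tau ^+ 2 + 2 * tau * eta].
Proof.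
move=> q1 q2.
have le_tau u : `|clip tau u| <= tau by rewrite norm_clip ge_min lexx orbT.
have le_id u : `|clip tau u| <= `|u| by rewrite norm_clip ge_min lexx.
have near_mul : `|clip tau x * clip tau y - q x * q y| <= 2 * tau * eta.
  rewrite (_ : _ - _ = clip tau x * (clip tau y - q y) +
    q y * (clip tau x - q x)); last by ring.
  apply: le_trans (ler_normD _ _) _; rewrite (normrM (clip tau x)) (normrM (q y)).
  have -> : 2 * tau * eta = tau * eta + tau * eta by ring.
  apply: lerD; apply: ler_pM => //.
  exact: le_trans (q1 y) (le_tau y).
split=> //.
  by rewrite !normrM; apply: ler_pM => //; exact: le_trans (q1 _) (le_id _).
rewrite -(subrKA (clip tau x * clip tau y)).
apply: le_trans (ler_normD _ _) _; apply: lerD => //.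
by have := clip_mul_bias x y; rewrite -!normrX !(ger0_norm (exprn_even_ge0 _ _)).
Qed.

End Clip.

(** * Moments of truncated products *)

Section TruncationMoments.
Context (d0 : measure_display) (T : measurableType d0) (K : realType).
Context (P : probability T K) (f g : T -> K) (M : K).
Hypothesis mf : measurable_fun setT f.
Hypothesis mg : measurable_fun setT g.
Hypothesis f4 : (\int[P]_w (`|f w| ^+ 4)%:E <= M%:E)%E.
Hypothesis g4 : (\int[P]_w (`|g w| ^+ 4)%:E <= M%:E)%E.
Hypothesis fg2 : (\int[P]_w (`|f w * g w| ^+ 2)%:E <= M%:E)%E.

Let mfg : measurable_fun setT (fun w => (f w * g w)%:E).
Proof. by apply/measurable_EFinP; exact: measurable_funM. Qed.

Let mfg2 : measurable_fun setT (fun w => (`|f w * g w| ^+ 2)%:E).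
Proof.
apply/measurable_EFinP; apply: measurable_funX.
by apply: measurableT_comp => //; exact: measurable_funM.
Qed.

(** Domination by [1 + (f g)^2], integrable since [P] is finite. *)
Lemma integrable_mul_of_sqr : P.-integrable setT (fun w => (f w * g w)%:E).
Proof.
apply: (@le_integrable _ _ _ P setT measurableT _
  (fun w => (1 + `|f w * g w| ^+ 2)%:E)) => //.
  move=> w _; rewrite !abse_EFin lee_fin [leRHS]ger0_norm; last first.
    by rewrite addr_ge0 // sqr_ge0.
  by have := sqr_ge0 (`|f w * g w| - 1); have := normr_ge0 (f w * g w); lra.
under [X in integrable _ _ X]eq_fun do rewrite EFinD.
apply: integrableD => //.
  by apply: finite_measure_integrable_cst.
apply/integrableP; split => //.
under eq_integral do rewrite gee0_abs ?lee_fin ?sqr_ge0 //.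
exact: le_lt_trans fg2 (ltry _).
Qed.

Lemma integral_sqr_le (h : T -> K) : measurable_fun setT h ->
  (forall w, `|h w| <= `|f w * g w|) -> (\int[P]_w (h w ^+ 2)%:E <= M%:E)%E.
Proof.
move=> mh hfg; apply: le_trans fg2; apply: ge0_le_integral => //.
- by move=> w _; rewrite lee_fin sqr_ge0.
- by apply/measurable_EFinP; exact: measurable_funX.
- by move=> w _; rewrite lee_fin -[leLHS]real_normK ?num_real // lerXn2r ?nnegrE.
Qed.

(** Integrates the pointwise bound. The weight [c] is left free: it will be [1 / tau^2] for
    truncation and [1 / (8 e)] in the degenerate case [M = 0]. *)
Lemma truncation_bias (h : T -> K) (c e m : K) :
  0 <= c -> 0 <= e ->
  P.-integrable setT (fun w => (h w)%:E) -> (\int[P]_w (h w)%:E = m%:E)%E ->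
  (forall w, `|f w * g w - h w| <= (`|f w| ^+ 4 + `|g w| ^+ 4) * c + e) ->
  `|fine (\int[P]_w (f w * g w)%:E)%E - m| <= 2 * M * c + e.
Proof.
move=> c0 e0 ih hm bnd; have ifg := integrable_mul_of_sqr.
rewrite -lee_fin -abse_EFin EFinB -hm fineK; last first.
  exact: integrable_fin_num.
rewrite -integralB //.
have m4 (u : T -> K) : measurable_fun setT u ->
    measurable_fun setT (fun w => (`|u w| ^+ 4)%:E).
  move=> mu; apply/measurable_EFinP; apply: measurable_funX.
  exact: measurableT_comp.
apply: le_trans (le_abse_integral _ _ _) _ => //.
  by apply: emeasurable_funB => //; exact: measurable_int ih.
apply: (@le_trans _ _ (\int[P]_w (c%:E * ((`|f w| ^+ 4)%:E + (`|g w| ^+ 4)%:E) + e%:E))%E).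
  apply: ge0_le_integral => //.
  - apply: measurableT_comp => //.
    by apply: emeasurable_funB => //; exact: measurable_int ih.
  - apply: emeasurable_funD => //; apply: emeasurable_funM => //.
    by apply: emeasurable_funD; exact: m4.
  - by move=> w _; have := bnd w; rewrite (mulrC _ c) -lee_fin.
have m44 : measurable_fun setT (fun w => (`|f w| ^+ 4)%:E + (`|g w| ^+ 4)%:E)%E.
  by apply: emeasurable_funD; exact: m4.
have ge4 u : (0 <= (`|u| ^+ 4)%:E :> \bar K)%E by rewrite lee_fin exprn_ge0.
have ge44 w : (0 <= (`|f w| ^+ 4)%:E + (`|g w| ^+ 4)%:E)%E by rewrite adde_ge0.
have gec w : (0 <= c%:E * ((`|f w| ^+ 4)%:E + (`|g w| ^+ 4)%:E))%E.
  by rewrite mule_ge0.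
rewrite ge0_integralD //; last by apply: emeasurable_funM.
rewrite ge0_integralZl // ge0_integralD //; try exact: m4.
rewrite integral_cst //= probability_setT mule1 EFinD leeD2r //.
rewrite (_ : 2 * M * c = c * (M + M)); last by ring.
by rewrite EFinM lee_wpmul2l // ?lee_fin // EFinD leeD.
Qed.

End TruncationMoments.

(** * Concentration of the truncated covariance *)

Section EntryTail.
Context (d n : nat) (M : R) (d0 : measure_display) (T : measurableType d0).
Context (P : probability T R) (X : T -> 'cV[R]_d) (Xs : 'I_n -> T -> 'cV[R]_d).
Hypothesis mX : forall j : 'I_d, real_measurable (fun w => X w j 0).
Hypothesis mXs : forall (i : 'I_n) (j : 'I_d), real_measurable (fun w => Xs i w j 0).
Hypothesis X4 : forall j : 'I_d, (\int[P]_w (`|X w j 0| ^+ 4)%:E <= M%:E)%E.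
Hypothesis X22 : forall j l : 'I_d,
  (\int[P]_w (`|X w j 0 * X w l 0| ^+ 2)%:E <= M%:E)%E.
Hypothesis XXs : forall i : 'I_n, same_law P X (Xs i).
Hypothesis Xs_indep : mutually_independent P Xs.

Variables (j l : 'I_d) (C : finType) (kap : R -> C).
Hypothesis mkap : forall c, measurable (kap @^-1` [set c] : set (measurableTypeR R)).

Let cell (x : 'cV[R]_d) : C * C := (kap (x j 0), kap (x l 0)).

(** Writes a cell event as a rectangle. The intersection also covers [j = l], where both constraints
    bear on one coordinate. *)
Let box (c : C * C) (m : 'I_d) : set R :=
  (if m == j then kap @^-1` [set c.1] else setT) `&`
  (if m == l then kap @^-1` [set c.2] else setT).

Let mbox c m : measurable (box c m : set (measurableTypeR R)).
Proof. by apply: measurableI; case: ifP => _ //; exact: mkap. Qed.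

Let cellE (x : 'cV[R]_d) c : cell x = c <-> forall m, box c m (x m 0).
Proof.
case: c => a b; rewrite /cell /box; split=> [[<- <-] m|H].
  by split; case: eqP => // ->.
have [+ _] := H j; have [_ +] := H l; rewrite !eqxx /=.
by move=> -> ->.
Qed.

Lemma measurable_cell (Y : T -> 'cV[R]_d) c :
  (forall m, real_measurable (fun w => Y w m 0)) ->
  measurable ((fun w => cell (Y w)) @^-1` [set c]).
Proof.
move=> mY; rewrite (_ : _ @^-1` _ =
    \bigcap_(m in setT) ((fun w => Y w m 0) @^-1` (box c m))).
  apply: fin_bigcap_measurable => // m _.
  by rewrite -[X in measurable X]setTI; exact: (mY m measurableT _ (mbox c m)).
apply/seteqP; split => [w /cellE H m _|w H]; first exact: H.
by apply/cellE => m; exact: (H m I).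
Qed.

(** Cell events are rectangles, so equality of laws and independence on rectangles yield the product
    rule that the Chernoff bound asks for. *)
Lemma cells_iid (c : {ffun 'I_n -> C * C}) :
  P [set w | forall i, cell (Xs i w) = c i] =
  (\prod_(i < n) mass _ _ _ P _ (fun w => cell (X w)) (c i))%:E.
Proof.
have boxE (Y : T -> 'cV[R]_d) b : [set w | cell (Y w) = b] =
    [set w | forall m, box b m (Y w m 0)].
  by apply/seteqP; split => w /cellE.
rewrite (_ : [set w | _] = [set w | forall i m, box (c i) m (Xs i w m 0)]); last first.
  by apply/seteqP; split => w H i; apply/cellE; exact: H.
rewrite (Xs_indep (fun i m => box (c i) m)); last by move=> i m; exact: mbox.
rewrite -prodEFin; apply: eq_bigr => i _.
rewrite -(XXs i (box (c i))) // massE; last by move=> b; exact: measurable_cell.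
by rewrite -boxE.
Qed.

Lemma sum_mass1 : \sum_c mass _ _ _ P _ (fun w => cell (X w)) c = 1.
Proof.
apply: EFin_inj; under eq_bigr do rewrite -[mass _ _ _ _ _ _ _]mul1r.
rewrite -(@integral_finite_range _ _ _ P _ (fun w => cell (X w)) _ (fun=> 1)).
  by rewrite integral_cst //= probability_setT mule1.
by move=> b; exact: measurable_cell.
Qed.

(** The sign [sg] selects the tail. Scaling by [1 / tau^2] makes the exponents at most 1. Bias [3r]
    and second-order term [2r] give [5r] in [b]; the threshold [10r] leaves a margin of [5r / tau^2]
    per observation. *)
Lemma quantized_tail (v : C -> R) (tau r sg : R) :
  0 < tau -> 0 < r -> M = tau ^+ 2 * r -> `|sg| = 1 ->
  (forall c, `|v c| <= tau) ->
  (forall x, `|v (kap x)| <= `|clip tau x|) ->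
  (forall x, `|clip tau x - v (kap x)| <= r / (2 * tau)) ->
  (P [set w | (n%:R * (sg * covariance_mx P X j l + 10 * r) / tau ^+ 2 <
      \sum_(i < n) (sg / tau ^+ 2 * (v (kap (Xs i w j 0)) * v (kap (Xs i w l 0)))))%R]
   <= (expR (- (5 * (n%:R * r / tau ^+ 2))))%:E)%E.
Proof.
move=> tau0 r0 ME sg1 vtau vclip vnear.
have t20 : 0 < tau ^+ 2 by rewrite exprn_gt0.
pose q x := v (kap x).
pose h w := q (X w j 0) * q (X w l 0).
pose vv (c : C * C) := v c.1 * v c.2.
pose mu := mass _ _ _ P _ (fun w => cell (X w)).
have mcell c : measurable ((fun w => cell (X w)) @^-1` [set c]).
  exact: measurable_cell.
have mu0 c : 0 <= mu c by exact: mass_ge0.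
have bnds x y := quantized_mul_bounds _ _ tau0 q _ x y vclip vnear.
have eta2 : 2 * tau * (r / (2 * tau)) = r by field; rewrite gt_eqF.
have ih : P.-integrable setT (fun w => (h w)%:E).
  exact: (integrable_finite_range _ _ _ P _ _ mcell vv).
have hE : (\int[P]_w (h w)%:E)%E = (\sum_c vv c * mu c)%:E.
  exact: (integral_finite_range _ _ _ P _ _ mcell vv).
(* Truncation contributes [2 M / tau^2 = 2r], rounding contributes [r]. *)
have bias : `|covariance_mx P X j l - \sum_c vv c * mu c| <= 3 * r.
  have := truncation_bias _ _ _ P _ _ M (mX j) (mX l) (X4 j) (X4 l) (X22 j l)
    h (tau ^- 2) r (\sum_c vv c * mu c).
  rewrite invr_ge0 (ltW t20) (ltW r0) => /(_ isT isT ih hE).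
  rewrite mxE ME (_ : 2 * _ * _ + r = 3 * r); last by field; rewrite gt_eqF.
  apply=> w; have [_ _] := bnds (X w j 0) (X w l 0); rewrite eta2; exact.
have var : \sum_c vv c ^+ 2 * mu c <= M.
  rewrite -lee_fin.
  rewrite -(integral_finite_range _ _ _ P _ _ mcell (fun c => vv c ^+ 2)).
  apply: (integral_sqr_le _ _ _ P _ _ M (mX j) (mX l) (X22 j l) h).
    by apply/measurable_EFinP; exact: measurable_int ih.
  by move=> w; have [] := bnds (X w j 0) (X w l 0).
pose z (c : C * C) := sg / tau ^+ 2 * vv c.
pose b := (sg * covariance_mx P X j l + 5 * r) / tau ^+ 2.
have mgf : \sum_c mu c * expR (z c) <= expR b.
  (* It suffices to bound the exponential moment by [1 + b]. *)
  apply: le_trans (expR_ge1Dx _).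
  have zle1 c : z c <= 1.
    apply: le_trans (ler_norm _) _; rewrite /z normrM normrM sg1 mul1r.
    rewrite normfV (gtr0_norm t20) mulrC ler_pdivrMr // mul1r expr2 normrM.
    by apply: ler_pM.
  apply: (@le_trans _ _ (\sum_c mu c * (1 + z c + 2 * z c ^+ 2))).
    by apply: ler_sum => c _; rewrite ler_wpM2l // expR_le_quadratic.
  have sg2 : sg ^+ 2 = 1 by rewrite -[sg ^+ 2]real_normK ?num_real // sg1 expr1n.
  have -> : \sum_c mu c * (1 + z c + 2 * z c ^+ 2) =
      1 + sg / tau ^+ 2 * (\sum_c vv c * mu c)
        + 2 / tau ^+ 4 * (\sum_c vv c ^+ 2 * mu c).
    rewrite -[X in _ = X + _ + _]sum_mass1 !mulr_sumr -!big_split /=; apply: eq_bigr => c _.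
    rewrite -/mu /z (_ : 2 * (_ * _) ^+ 2 = 2 / tau ^+ 4 * vv c ^+ 2 * sg ^+ 2).
      by rewrite sg2; ring.
    by field; rewrite gt_eqF.
  rewrite -addrA lerD2l /b.
  have H1 : sg * (\sum_c vv c * mu c) <= sg * covariance_mx P X j l + 3 * r.
    rewrite -lerBlDl -mulrBr; apply: le_trans (ler_norm _) _.
    by rewrite normrM sg1 mul1r distrC.
  have H2 : 2 / tau ^+ 4 * (\sum_c vv c ^+ 2 * mu c) <= 2 * r / tau ^+ 2.
    rewrite (_ : 2 * r / _ = 2 / tau ^+ 4 * M); last first.
      by rewrite ME; field; rewrite gt_eqF.
    by rewrite ler_wpM2l // divr_ge0 // exprn_ge0 // ltW.
  apply: le_trans (lerD (lexx _) H2) _.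
  rewrite mulrAC -mulrDl ler_pM2r ?invr_gt0 //; lra.
have := chernoff_finite_range _ _ _ P _ n (fun i w => cell (Xs i w)) mu _ _
  z (n%:R * (sg * covariance_mx P X j l + 10 * r) / tau ^+ 2) b mu0 mgf.
rewrite (_ : n%:R * b - _ = - (5 * (n%:R * r / tau ^+ 2))); last first.
  by rewrite /b; field; rewrite gt_eqF.
apply.
- by move=> i c; exact: measurable_cell.
- exact: cells_iid.
Qed.

End EntryTail.

(** * Union bound over all entries and calibration of [tau] *)

Lemma union_bound (d0 : measure_display) (T : measurableType d0) (K : realType)
    (P : probability T K) (I : finType) (F : I -> set T) (b : K) :
  (forall i, measurable (F i)) -> (forall i, (P (F i) <= b%:E)%E) ->
  (P (\big[setU/set0]_i F i) <= (#|I|%:R * b)%:E)%E.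
Proof.
move=> mF Fb; rewrite cardE enumT [index_enum _]unlock.
elim: (Finite.enum I) => [|i t IHt]; first by rewrite big_nil measure0 mul0r.
rewrite big_cons /= -nat1r mulrDl mul1r EFinD.
apply: le_trans (leeD (Fb i) IHt); apply: measureU2 => //.
exact: bigsetU_measurable.
Qed.

Section Concentration.
Context (d n : nat) (M : R) (d0 : measure_display) (T : measurableType d0).
Context (P : probability T R) (X : T -> 'cV[R]_d) (Xs : 'I_n -> T -> 'cV[R]_d).
Hypothesis d2 : (2 <= d)%N.
Hypothesis n0 : (0 < n)%N.
Hypothesis mX : forall j : 'I_d, real_measurable (fun w => X w j 0).
Hypothesis mXs : forall (i : 'I_n) (j : 'I_d), real_measurable (fun w => Xs i w j 0).
Hypothesis X4 : forall j : 'I_d, (\int[P]_w (`|X w j 0| ^+ 4)%:E <= M%:E)%E.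
Hypothesis X22 : forall j l : 'I_d,
  (\int[P]_w (`|X w j 0 * X w l 0| ^+ 2)%:E <= M%:E)%E.
Hypothesis XXs : forall i : 'I_n, same_law P X (Xs i).
Hypothesis Xs_indep : mutually_independent P Xs.

Let S := covariance_mx P X.
Let Sbar tau w := Sigma_bar tau (fun i => Xs i w).

Lemma Sigma_barE tau w j l :
  Sbar tau w j l = n%:R^-1 * \sum_(i < n) (clip tau (Xs i w j 0) * clip tau (Xs i w l 0)).
Proof.
rewrite /Sbar /Sigma_bar mxE summxE; congr (_ * _); apply: eq_bigr => i _.
by rewrite mxE big_ord1 !mxE.
Qed.

(** Compares with the zero variable: [|x y| <= (x^4 + y^4) / (8 e) + e] for every [e > 0], and the
    fourth moments vanish. *)
Lemma covariance_mx_eq0 : M = 0 -> S = 0.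
Proof.
move=> M0; apply/matrixP => j l; rewrite mxE [RHS]mxE.
have int0 : (\int[P]_w (0 : R)%:E = 0%:E)%E by rewrite integral0.
apply/eqP; rewrite -normr_le0; apply/ler_addgt0Pr => e e0; rewrite add0r.
rewrite -[X in `|X|]subr0.
have := truncation_bias _ _ _ P _ _ M (mX j) (mX l) (X4 j) (X4 l) (X22 j l)
  (fun=> 0) (8 * e)^-1 e 0.
rewrite invr_ge0 mulr_ge0 ?(ltW e0) // => /(_ isT isT (integrable0 _ _) int0).
rewrite M0 mulr0 mul0r add0r; apply=> w; rewrite subr0 normrM.
set a := `|_|; set b := `|_|; rewrite -lerBlDr ler_pdivlMr ?mulr_gt0 //.
have := sqr_ge0 (a * b - 2 * e); have := sqr_ge0 (a ^+ 2 - b ^+ 2); nra.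
Qed.

(** The two equations on [r] and [tau] balance bias against variance and make the exponent
    [5 log d]. The error is [10r] from the tails of both signs, plus [r] for rounding the sample. *)
Lemma covariance_concentration (tau r : R) :
  0 < tau -> 0 < r -> M = tau ^+ 2 * r -> n%:R * r / tau ^+ 2 = ln d%:R ->
  exists E : set T, measurable E /\ (P E >= (1 - (d%:R ^+ 2)^-1)%:E)%E /\
    forall w, E w -> forall j l, `|Sbar tau w j l - S j l| <= 11 * r.
Proof.
move=> tau0 r0 ME rL.
have eta0 : 0 < r / (2 * tau) by rewrite divr_gt0 // mulr_gt0.
have [C [kap [v [mkap [vtau vP]]]]] := clip_grid _ _ tau0 _ eta0.
have vclip x : `|v (kap x)| <= `|clip tau x| by have [] := vP x.
have vnear x : `|clip tau x - v (kap x)| <= r / (2 * tau) by have [] := vP x.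
pose q x := v (kap x).
pose I3 : finType := ('I_d * 'I_d * bool)%type.
pose thr (p : I3) := n%:R * ((-1) ^+ p.2 * S p.1.1 p.1.2 + 10 * r) / tau ^+ 2.
pose stat (p : I3) w := \sum_(i < n)
  ((-1) ^+ p.2 / tau ^+ 2 * (q (Xs i w p.1.1 0) * q (Xs i w p.1.2 0))).
pose Bad p := [set w | thr p < stat p w].
have mBad p : measurable (Bad p).
  pose z (c : C * C) := (-1) ^+ p.2 / tau ^+ 2 * (v c.1 * v c.2) : R.
  apply: (measurable_sum_gt _ _ _ _ n
    (fun i w => (kap (Xs i w p.1.1 0), kap (Xs i w p.1.2 0))) _ z (thr p)).
  by move=> i c; exact: (measurable_cell _ _ _ _ _ _ _ mkap).
have PBad p : (P (Bad p) <= ((d%:R ^+ 5)^-1)%:E)%E.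
  have -> : (d%:R ^+ 5)^-1 = expR (- (5 * (n%:R * r / tau ^+ 2))) :> R.
    by rewrite rL expRN expRM_natl lnK // posrE ltr0n (leq_trans _ d2).
  have sg1 : `|(-1) ^+ p.2 : R| = 1 by rewrite normrX normrN1 expr1n.
  exact: (quantized_tail _ n M _ _ P X Xs mX mXs X4 X22 XXs Xs_indep
    p.1.1 p.1.2 C kap mkap v tau r _ tau0 r0 ME sg1 vtau vclip vnear).
pose E := ~` \big[setU/set0]_p Bad p.
have mU : measurable (\big[setU/set0]_p Bad p) by exact: bigsetU_measurable.
exists E; split; [exact: measurableC|split].
  rewrite /E probability_setC // EFinB leeB //.
  apply: le_trans (union_bound _ _ _ P _ _ _ mBad PBad) _.
  rewrite lee_fin !card_prod card_ord card_bool !natrM.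
  have D2 : 2 <= d%:R :> R by rewrite ler_nat.
  have D0 : 0 < d%:R :> R by lra.
  rewrite -[leRHS]mul1r ler_pdivlMr ?exprn_gt0 //.
  (* There are [2 d^2] bad events of probability at most [d^-5], and [2 d^-3 <= d^-2] because
     [d >= 2]. *)
  rewrite (_ : _ * _ * _ * _ = 2 / d%:R); last by field; rewrite gt_eqF.
  by rewrite ler_pdivrMr // mul1r.
move=> w Ew j l.
have good p : stat p w <= thr p.
  rewrite leNgt; apply/negP => badp; apply: Ew.
  by rewrite -bigcup_seq; exists p => //=; rewrite mem_index_enum.
have nr : 0 < n%:R :> R by rewrite ltr0n.
have t20 : 0 < tau ^+ 2 by rewrite exprn_gt0.
have quant : `|\sum_(i < n) (clip tau (Xs i w j 0) * clip tau (Xs i w l 0)) -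
    \sum_(i < n) (q (Xs i w j 0) * q (Xs i w l 0))| <= n%:R * r.
  rewrite -sumrB; apply: le_trans (ler_norm_sum _ _ _) _.
  rewrite mulr_natl -[X in _ *+ X]card_ord -sumr_const; apply: ler_sum => i _.
  have [_ + _] := quantized_mul_bounds _ _ tau0 q _ (Xs i w j 0) (Xs i w l 0) vclip vnear.
  by rewrite (_ : 2 * tau * _ = r) //; field; rewrite gt_eqF.
have dev (b : bool) : (-1) ^+ b * \sum_(i < n) (q (Xs i w j 0) * q (Xs i w l 0)) <=
    n%:R * ((-1) ^+ b * S j l + 10 * r).
  have := good (j, l, b); rewrite /thr /stat /= -mulr_sumr.
  by rewrite mulrAC ler_pM2r ?invr_gt0.
move: (dev true) (dev false) quant; rewrite Sigma_barE /= expr1 expr0.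
set A := \sum_(i < n) _; set B := \sum_(i < n) _ => dev1 dev0.
rewrite ler_norml => /andP[q1 q2].
rewrite (_ : _ * B - _ = (B - n%:R * S j l) / n%:R); last by field; rewrite gt_eqF.
rewrite normrM normfV (gtr0_norm nr).
rewrite ler_pdivrMr // ler_norml; lra.
Qed.

Lemma covariance_event :
  let lambda := 55 / 2 * Num.sqrt (M * ln d%:R / n%:R) in
  let tau := powR (1 * M * n%:R / ln d%:R) (4%:R^-1) in
  exists E : set T, measurable E /\ (P E >= (1 - (d%:R ^+ 2)^-1)%:E)%E /\
    forall w, E w -> forall j l, `|Sbar tau w j l - S j l| <= 2 / 5 * lambda.
Proof.
move=> lambda tau.
have j0 : 'I_d by case: d d2 => // d' _; exact: ord0.
have M0 : 0 <= M.
  rewrite -lee_fin; apply: le_trans (X4 j0); apply: integral_ge0 => w _.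
  by rewrite lee_fin exprn_ge0.
have nr : 0 < n%:R :> R by rewrite ltr0n.
have L0 : 0 < ln d%:R :> R by rewrite ln_gt0 // ltr1n.
move: M0; rewrite le_eqVlt => /orP[/eqP/esym M0|M0].
  exists setT; split; [exact: measurableT|split].
    by rewrite probability_setT lee_fin gerBl invr_ge0 exprn_ge0.
  (* For [M = 0] the level [tau] is 0, so the sample matrix vanishes, as does the covariance. *)
  have tauE : tau = 0 by rewrite /tau M0 mulr0 !mul0r powR0 // invr_neq0.
  move=> w _ j l; rewrite covariance_mx_eq0 // Sigma_barE big1 => [|i _].
    by rewrite mxE mulr0 subrr normr0 /lambda M0 !mul0r sqrtr0 !mulr0.
  by rewrite tauE /clip min_r // mulr0 mul0r.
set r := Num.sqrt (M * ln d%:R / n%:R) in lambda *.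
have r0 : 0 < r by rewrite sqrtr_gt0 divr_gt0 // mulr_gt0.
have tau0 : 0 < tau by rewrite powR_gt0 // mul1r divr_gt0 // mulr_gt0.
have tau4 : tau ^+ 4 = M * n%:R / ln d%:R.
  rewrite /tau -powR_mulrn ?powR_ge0 // -powRrM mulVf // powRr1 mul1r //.
  by rewrite divr_ge0 ?mulr_ge0 // ltW.
have ME : M = tau ^+ 2 * r.
  (* Both sides are nonnegative, so their squares are compared: [tau^4 r^2 = M^2]. *)
  apply/eqP; rewrite -(eqrXn2 (n := 2)) ?ltW // ?mulr_gt0 ?exprn_gt0 //.
  rewrite exprMn -exprM tau4 sqr_sqrtr; last by rewrite ltW // divr_gt0 // mulr_gt0.
  by apply/eqP; field; rewrite !gt_eqF.
have rL : n%:R * r / tau ^+ 2 = ln d%:R.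
  have t2 : tau ^+ 2 != 0 by rewrite gt_eqF // exprn_gt0.
  apply: (mulIf t2); rewrite divfK //; apply: (mulIf t2).
  rewrite (_ : n%:R * r * _ = n%:R * M); last by rewrite [in RHS]ME; ring.
  rewrite (_ : ln _ * _ * _ = ln d%:R * tau ^+ 4); last by ring.
  by rewrite tau4; field; rewrite gt_eqF.
have [E [mE [PE EP]]] := covariance_concentration _ _ tau0 r0 ME rL.
exists E; split=> //; split=> // w Ew j l.
by apply: le_trans (EP w Ew j l) _; rewrite /lambda; lra.
Qed.

End Concentration.

Theorem mainTheorem9 :
  exists C1 C2 : R, 0 < C1 /\ 0 < C2 /\
  forall (d k n s : nat) (M : R) (d0 : measure_display) (T : measurableType d0)
    (P : probability T R) (X : T -> 'cV[R]_d) (Xs : 'I_n -> T -> 'cV[R]_d)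
    (lamS : nat -> R) (Vstar : 'M[R]_(d, k)),
    (2 <= d)%N -> (0 < k < d)%N -> (0 < n)%N ->
    (* measurability of X and of the sample *)
    (forall j : 'I_d, real_measurable (fun w => X w j 0)) ->
    (forall (i : 'I_n) (j : 'I_d), real_measurable (fun w => Xs i w j 0)) ->
    (* E X = 0 *)
    (forall j : 'I_d, P.-integrable setT (fun w => (X w j 0)%:E) /\
                      (\int[P]_w (X w j 0)%:E = 0)%E) ->
    (* moment assumptions *)
    (forall j : 'I_d, (\int[P]_w (`|X w j 0| ^+ 4)%:E <= M%:E)%E) ->
    (forall j l : 'I_d,
        (\int[P]_w (`|X w j 0 * X w l 0| ^+ 2)%:E <= M%:E)%E) ->
    (* X_1, ..., X_n are i.i.d. copies of X *)
    (forall i : 'I_n, same_law P X (Xs i)) ->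
    mutually_independent P Xs ->
    (* eigen-structure of Sigma = E[X X^T] *)
    sorted_eigenvalues (covariance_mx P X) lamS ->
    0 < lamS k.-1 - lamS k ->
    top_eigvecs (covariance_mx P X) lamS Vstar ->
    (#|[set j : 'I_d | row j Vstar != 0%R]| <= s)%N ->
    let lambda := C1 * Num.sqrt (M * ln d%:R / n%:R) in
    let tau := powR (C2 * M * n%:R / ln d%:R) (4%:R^-1) in
    let rho0 := lamS k.-1 - lamS k in
    exists E : set T, measurable E /\
      (P E >= (1 - (d%:R ^+ 2)^-1)%:E)%E /\
      forall w, E w ->
        forall (What : 'M[R]_d) (mu : nat -> R) (Vhat : 'M[R]_(d, k)),
          is_maximizer k lambda (Sigma_bar tau (fun i => Xs i w)) What ->
          sorted_eigenvalues What mu ->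
          top_eigvecs What mu Vhat ->
          inf [set x | exists O : 'M[R]_k, orthogonal_mx O /\
                                           x = frob (Vhat - Vstar *m O)]
            <= 4 * Num.sqrt 2 / rho0 * s%:R * lambda.

Proof.
(* [C1 = 55/2] makes the entrywise error [11 r] equal to [(2/5) lambda]. *)
exists (55 / 2), 1; split; [by lra|split; first by []].
move=> d k n s M d0 T P X Xs lamS Vstar d2 kd n0 mX mXs _ X4 X22 XXs Xs_indep.
move=> Alam gap0 VA Vs lambda tau rho0.
have [E [mE [PE EP]]] :=
  covariance_event _ n M _ _ P X Xs d2 n0 mX mXs X4 X22 XXs Xs_indep.
exists E; split=> //; split=> // w Ew What mu Vhat Wmax Wmu VW.
apply: (sparse_pca_deterministic _ _ _ _ _ _ _ _ _ _ _ kd Alam gap0 VA Vs _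
  (EP w Ew) Wmax Wmu VW).
by rewrite mulr_ge0 ?sqrtr_ge0 //; lra.
Qed.
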